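(* Fix $\lambda>0$ and $\beta\ge0$, let $\mathbb P$ be the law of the Erdős–Rényi random graph $G_{n,p_n}$ with $p_n=\lambda/n$, and consider the exponential random graph with law $\mathbb P_{\beta\log n}$ on graphs on $[n]$ given by $$\frac{d\mathbb P_{\beta\log n}}{d\mathbb P}=\frac1{Z_n(\beta\log n)}\,e^{(\beta\log n)V_T},\qquad Z_n(\beta\log n)=\mathbb E\big[e^{(\beta\log n)V_T}\big].$$ Then $$\lim_{n\to\infty}\frac1{n\log n}\log Z_n(\beta\log n)=(\beta-\tfrac13)_+ .$$ Moreover, under $\mathbb P_{\beta\log n}$, as $n\to\infty$: when $\beta<\tfrac13$, $V_T/n$ converges in probability to $0$; and when $\beta>\tfrac13$, $V_T/n$ converges in probability to $1$.
   Context: In $G_{n,p}$ each edge of the complete graph on $[n]=\{1,\dots,n\}$ is present independently with probability $p$. $V_T$ is the number of vertices of the graph that are part of a triangle. $\mathbb E$ is expectation with respect to $\mathbb P$, and $(x)_+=\max\{x,0\}$. *)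

(* Defs.v *)
From mathcomp Require Import all_boot all_order all_algebra.
From mathcomp Require Import all_classical all_reals all_analysis.

Set Implicit Arguments.
Unset Strict Implicit.
Unset Printing Implicit Defensive.
Import Order.TTheory GRing.Theory Num.Theory.
Import numFieldNormedType.Exports.
Local Open Scope classical_set_scope.
Local Open Scope ring_scope.

(* The vertex set [n] is represented by 'I_n = {0, ..., n-1}. *)
Definition edge (n : nat) : Type := {e : {set 'I_n} | #|e| == 2}.

Definition graph (n : nat) : Type := {set edge n}.

Definition adj (n : nat) (G : graph n) (i j : 'I_n) : bool :=
  [exists e : edge n, (e \in G) && (val e == [set i; j]%SET)].

(* No distinctness condition is needed: adj G i j implies i != j. *)
Definition in_triangle (n : nat) (G : graph n) (i : 'I_n) : bool :=
  [exists j, exists k, [&& adj G i j, adj G j k & adj G k i]].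

Definition V_T (n : nat) (G : graph n) : nat := #|in_triangle G|.

(* Probability mass function on graphs of G_{n,p}. It is a probability law
   only for 0 <= p <= 1; with p = lambda / n this holds for all n >= lambda,
   n > 0, so limits as n -> oo are unaffected by the other values of n. *)
Definition gnp {R : realType} (n : nat) (p : R) (G : graph n) : R :=
  \prod_(e : edge n) (if e \in G then p else 1 - p).

Definition Pr {R : realType} (n : nat) (mu : graph n -> R)
    (A : {pred graph n}) : R :=
  \sum_(G : graph n | G \in A) mu G.

Definition Ex {R : realType} (n : nat) (mu : graph n -> R)
    (X : graph n -> R) : R :=
  \sum_(G : graph n) mu G * X G.

Definition Z {R : realType} (n : nat) (p gamma : R) : R :=
  Ex (@gnp R n p) (fun G => expR (gamma * (V_T G)%:R)).

Definition ergm {R : realType} (n : nat) (p gamma : R) (G : graph n) : R :=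
  (Z n p gamma)^-1 * expR (gamma * (V_T G)%:R) * gnp p G.

Definition cvg_in_probability {R : realType} (mu X : forall n, graph n -> R)
    (c : R) : Prop :=
  forall eps : R, 0 < eps ->
    (fun n => Pr (mu n) [pred G | eps < `|X n G - c|]) @ \oo --> (0 : R).

(* Main.v *)
(* Everything follows from two estimates at the critical slope, with p = lambda / n.
   Upper bound: E[n^(V_T / 3)] <= exp (C n). Scan the vertices; whenever one lies
   in a triangle but in none of those chosen so far, choose such a triangle. It
   has at least two new edges, and three unless its third edge was already
   revealed, so the choices have total weight O(n^2 p^3 + n p^2) = O(1 / n),
   while each of them covers at most three new vertices.
   Lower bound: the (m!)^2 graphs that consist of m = n / 3 disjoint triangles
   given by two permutations have total mass n^(- n / 3) exp (- O(n)), and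
   V_T >= n - 2 on each.
   Hence the weight n^(beta V_T) restricted to an event has expectation at most
   exp (max (beta - 1/3) V_T log n + O(n)), which gives both the limit of log Z_n
   and the concentration of V_T. *)

Require Import Defs.
From mathcomp Require Import all_boot all_order all_algebra all_fingroup.
From mathcomp Require Import all_classical all_reals all_analysis.
From mathcomp Require Import ring lra zify.
Set Implicit Arguments.
Unset Strict Implicit.
Unset Printing Implicit Defensive.
Import Order.TTheory GRing.Theory Num.Theory.
Import numFieldNormedType.Exports.
Local Open Scope classical_set_scope.
Local Open Scope ring_scope.

(** * Edges, adjacency and the edges of a triangle *)

Lemma edge_of_neq n (i j : 'I_n) : i != j ->
  exists e : edge n, val e = [set i; j]%SET.
Proof.
move=> neq_ij; have h : #|[set i; j]%SET| == 2%N by rewrite cards2 neq_ij.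
by exists (exist _ [set i; j]%SET h).
Qed.

Lemma adjP n (G : graph n) (i j : 'I_n) :
  reflect (exists2 e : edge n, e \in G & val e = [set i; j]%SET) (adj G i j).
Proof.
apply: (iffP existsP) => [[e /andP[eG /eqP ve]]|[e eG ve]]; exists e => //.
by rewrite eG ve eqxx.
Qed.

Lemma adj_neq n (G : graph n) (i j : 'I_n) : adj G i j -> i != j.
Proof.
case/adjP=> e _ ve; have := valP e; rewrite /= ve cards2.
by case: (i != j).
Qed.

(** An adjacent ordered pair lies in the square of some [val e], which has four elements, its
    diagonal included. *)
Lemma card_adj n (E : graph n) :
  (#|[set x : 'I_n * 'I_n | adj E x.1 x.2]%SET| <= 4 * #|E|)%N.
Proof.
have sub : [set x : 'I_n * 'I_n | adj E x.1 x.2]%SET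
    \subset (\bigcup_(e in E) finset.setX (val e) (val e))%SET.
  apply/fintype.subsetP => -[a b]; rewrite inE /= => /adjP[e eE ve].
  by apply/finset.bigcupP; exists e => //; rewrite inE /= ve !inE !eqxx orbT.
apply: (leq_trans (subset_leq_card sub)).
rewrite mulnC -sum_nat_const; elim/big_ind2: _ => [|k A l B Ak Bl|e _].
- by rewrite cards0.
- by rewrite (leq_trans (leq_card_setU A B)) // leq_add.
- by rewrite cardsX (eqP (valP e)).
Qed.

Definition touched n (E : graph n) (i : 'I_n) : bool :=
  [exists e in E, i \in (val e : {set 'I_n})].

Lemma touched0 n (i : 'I_n) : touched finset.set0 i = false.
Proof. by apply/existsP => -[e]; rewrite inE. Qed.

(** Selecting among the edges makes this total: if two vertices coincide, their pair is a singleton,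
    which is no [val e], and contributes nothing. *)
Definition triangle_edges n (i a b : 'I_n) : graph n :=
  [set e : edge n |
    [|| val e == [set i; a] , val e == [set i; b] | val e == [set a; b]]]%SET.

Lemma triangle_edges_sub n (G : graph n) (i a b : 'I_n) :
  adj G i a -> adj G a b -> adj G b i -> triangle_edges i a b \subset G.
Proof.
move=> /adjP[e1 G1 v1] /adjP[e2 G2 v2] /adjP[e3 G3 v3].
apply/fintype.subsetP => e; rewrite inE => /or3P[] /eqP ve.
- by rewrite (_ : e = e1) //; apply: val_inj; rewrite ve v1.
- by rewrite (_ : e = e3) //; apply: val_inj; rewrite ve v3 finset.setUC.
- by rewrite (_ : e = e2) //; apply: val_inj; rewrite ve v2.
Qed.

Lemma touched_triangle n (E : graph n) (i a b x : 'I_n) :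
  touched (E :|: triangle_edges i a b) x -> x \notin [:: i; a; b] ->
  touched E x.
Proof.
case/existsP=> e /andP[]; rewrite !inE => /orP[eE xe _|].
  by apply/existsP; exists e; rewrite eE.
by case/or3P=> /eqP ->; rewrite !inE => /orP[] ->; rewrite ?orbT.
Qed.

(* Both edges at [i] are new since no edge of [E] touches [i]. *)
Lemma card_add_triangle n (E : graph n) (i a b : 'I_n) :
  ~~ touched E i -> i != a -> i != b -> a != b ->
  exists k, [/\ #|(E :|: triangle_edges i a b)%SET| = (k + #|E|)%N,
    (k <= 3)%N & k = (3 - adj E a b)%N].
Proof.
move=> unt ia ib ab.
have [e1 v1] := edge_of_neq ia.
have [e2 v2] := edge_of_neq ib.
have [e3 v3] := edge_of_neq ab.
have notE e : i \in (val e : {set 'I_n}) -> e \notin E.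
  by move=> ie; apply: contra unt => eE; apply/existsP; exists e; rewrite eE.
have E1 : e1 \notin E by apply: notE; rewrite v1 !inE eqxx.
have E2 : e2 \notin E by apply: notE; rewrite v2 !inE eqxx.
have tE : triangle_edges i a b = [set e1; e2; e3]%SET.
  by apply/setP => e; rewrite !inE -!val_eqE /= v1 v2 v3 orbA.
have n12 : e1 != e2.
  apply/eqP => /(congr1 val); rewrite v1 v2 => /setP/(_ a).
  by rewrite !inE eqxx orbT eq_sym (negPf ia) (negPf ab).
have ni3 e : i \in (val e : {set 'I_n}) -> e != e3.
  apply: contraTneq => ->.
  by rewrite v3 !inE (negPf ia) (negPf ib).
have n13 : e1 != e3 by apply: ni3; rewrite v1 !inE eqxx.
have n23 : e2 != e3 by apply: ni3; rewrite v2 !inE eqxx.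
have adjE : adj E a b = (e3 \in E).
  apply/adjP/idP => [[e eE ve]|e3E]; last by exists e3.
  by rewrite (_ : e3 = e) //; apply: val_inj; rewrite ve v3.
exists (3 - (e3 \in E))%N; split; [|exact: leq_subr|by rewrite adjE].
rewrite tE finset.setUC -!finset.setUA !cardsU1 !inE.
rewrite (negPf E1) (negPf E2) (negPf n12) (negPf n13) (negPf n23) /=.
by case: (e3 \in E).
Qed.

(** * Upper bound on the moments of [V_T] under [gnp] *)

Section Gnp.
Variables (R : realType) (n : nat) (p : R).
Hypotheses (p_ge0 : 0 <= p) (p_le1 : p <= 1).

Lemma gnp_ge0 (G : graph n) : 0 <= gnp p G.
Proof. by apply: prodr_ge0 => e _; case: ifP => _ //; rewrite subr_ge0. Qed.

Lemma gnp_supset (E : graph n) :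
  \sum_(G : graph n | E \subset G) gnp p G = p ^+ #|E|.
Proof.
(* [F e + H e] is [p] on [E] and 1 off [E]. The expanded product has one term per graph [G], with
   [F] on [G] and [H] off it; as [H] vanishes on [E], only supersets of [E] survive. *)
pose F (e : edge n) := p.
pose H (e : edge n) := if e \in E then 0 else 1 - p.
have <- : \prod_(e : edge n) (F e + H e) = p ^+ #|E|.
  rewrite -prodr_const [RHS]big_mkcond /=; apply: eq_bigr => e _.
  by rewrite /F /H; case: ifP => _; rewrite ?addr0 ?subrKC.
rewrite bigA_distr big_mkcond; apply: eq_bigr => /= G _.
case: ifPn => [/fintype.subsetP sEG|/subsetPn[e eE eG]].
  apply: eq_bigr => e _; rewrite /F /H; case: ifPn => // eG.
  by rewrite (contraNF (sEG e)).
by rewrite (bigD1 e) //= /H (negPf eG) eE mul0r.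
Qed.

Lemma sum_gnp : \sum_(G : graph n) gnp p G = 1.
Proof.
have := gnp_supset finset.set0; rewrite cards0 expr0 => <-.
by apply: eq_bigl => G; rewrite finset.sub0set.
Qed.

Definition uncovered (E G : graph n) (x : 'I_n) : bool :=
  in_triangle G x && ~~ touched E x.

(** The new triangle can only cover [i], [a] and [b], and each occurs at most once in [i :: l]. *)
Lemma count_uncovered_triangle (E G : graph n) (i a b : 'I_n) (l : seq 'I_n) :
  uniq (i :: l) ->
  (count (uncovered E G) (i :: l) <=
    3 + count (uncovered (E :|: triangle_edges i a b)%SET G) l)%N.
Proof.
case/andP=> il ul.
set Q := uncovered (_ :|: _)%SET G.
have sub : {in l, forall x, uncovered E G x ->
    predU Q (predU (pred1 a) (pred1 b)) x}.
  move=> x xl /andP[tx ux] /=; apply/norP => -[nQ /norP[xa xb]].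
  case/negP: nQ; rewrite /Q /uncovered tx /=; apply: contra ux.
  move/touched_triangle; apply; rewrite !inE (negPf xa) (negPf xb) !orbF.
  by apply: contraNneq il => <-.
have c1 : (count (uncovered E G) l <=
    count (predU Q (predU (pred1 a) (pred1 b))) l)%N.
  rewrite -!size_filter; apply: uniq_leq_size; first exact: filter_uniq.
  move=> x; rewrite !mem_filter => /andP[ux xl]; rewrite xl andbT.
  exact: sub.
have c3 : (count (predU (pred1 a) (pred1 b)) l <= 2)%N.
  rewrite (@leq_trans (count_mem a l + count_mem b l)) //.
    by rewrite -count_predUI leq_addr.
  by rewrite !count_uniq_mem // (leq_add (leq_b1 _) (leq_b1 _)).
rewrite -[3%N]/(1 + 2)%N -addnA /= leq_add ?leq_b1 // (leq_trans c1) // addnC.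
apply: leq_trans (leq_add (leqnn _) c3).
by rewrite -count_predUI leq_addr.
Qed.

Lemma triangle_weight (E : graph n) (i : 'I_n) :
  ~~ touched E i ->
  \sum_(x : 'I_n * 'I_n | [&& i != x.1, i != x.2 & x.1 != x.2])
     p ^+ #|(E :|: triangle_edges i x.1 x.2)%SET|
  <= p ^+ #|E| * (n%:R ^+ 2 * p ^+ 3 + 4 * #|E|%:R * p ^+ 2).
Proof.
move=> unt.
(* A pair reveals three new edges, or two if [a] and [b] are already adjacent in [E]. Allowing both
   weights in the latter case lets the sum split, and [card_adj] bounds the second part. *)
apply: (@le_trans _ _ (\sum_(x : 'I_n * 'I_n)
    p ^+ #|E| * (p ^+ 3 + (adj E x.1 x.2)%:R * p ^+ 2))).
  rewrite big_mkcond; apply: ler_sum => -[a b] _ /=.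
  have rhs_ge0 : 0 <= p ^+ #|E| * (p ^+ 3 + (adj E a b)%:R * p ^+ 2).
    by rewrite mulr_ge0 ?addr_ge0 ?mulr_ge0 ?exprn_ge0 ?ler0n.
  case: ifP => // /and3P[ia ib ab].
  have [k [-> _ ->]] := card_add_triangle unt ia ib ab.
  rewrite exprD mulrC ler_wpM2l ?exprn_ge0 //.
  case: (adj E a b); rewrite /= ?mul1r ?mul0r ?addr0 //.
  by rewrite lerDr exprn_ge0.
rewrite -mulr_sumr big_split /= sumr_const card_prod card_ord.
rewrite -mulr_suml -natr_sum -[p ^+ 3 *+ _]mulr_natl natrM -expr2.
rewrite ler_wpM2l ?exprn_ge0 // lerD2l ler_wpM2r ?exprn_ge0 //.
rewrite -natrM ler_nat; apply: leq_trans (card_adj E).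
by rewrite -sum1_card [leqRHS]big_mkcond /=; apply: leq_sum => x _; rewrite inE.
Qed.

(* [E] is the set of edges revealed so far, [l] the list of vertices still to be
   scanned; [#|E| + 3 * size l <= 3 * n] holds since each scanned vertex reveals
   at most three edges. *)
Lemma greedy_moment (y : R) (l : seq 'I_n) (E : graph n) :
  1 <= y -> uniq l -> (#|E| + 3 * size l <= 3 * n)%N ->
  \sum_(G : graph n | E \subset G) gnp p G * y ^+ count (uncovered E G) l
  <= p ^+ #|E| *
     (1 + y ^+ 3 * (n%:R ^+ 2 * p ^+ 3 + 12 * n%:R * p ^+ 2)) ^+ size l.
Proof.
move=> y_ge1; have y_ge0 : 0 <= y by exact: le_trans y_ge1.
have expand (u v w z : R) : u * w + z * (u * v * w) = u * ((1 + z * v) * w).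
  by ring.
set c := n%:R ^+ 2 * p ^+ 3 + _.
have c_ge0 : 0 <= c by rewrite addr_ge0 ?mulr_ge0 ?exprn_ge0 ?ler0n.
elim: l E => [|i l IHl] E.
  move=> _ _; rewrite /= mulr1 -gnp_supset le_eqVlt; apply/orP; left.
  by apply/eqP; apply: eq_bigr => G _; rewrite mulr1.
move=> ul sE; have ul' : uniq l by case/andP: ul.
have sE' k : (k <= 3 -> k + #|E| + 3 * size l <= 3 * n)%N.
  move=> k3; apply: leq_trans sE; rewrite /= mulnS.
  by rewrite addnAC addnC leq_add2l leq_add2r.
have IH0 : \sum_(G : graph n | E \subset G)
    gnp p G * y ^+ count (uncovered E G) l
    <= p ^+ #|E| * (1 + y ^+ 3 * c) ^+ size l.
  by apply: IHl => //; exact: sE' 0%N _.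
have d_ge1 : 1 <= 1 + y ^+ 3 * c by rewrite lerDl mulr_ge0 ?exprn_ge0.
have d_ge0 : 0 <= 1 + y ^+ 3 * c by exact: le_trans d_ge1.
have [ti|unt] := boolP (touched E i).
  apply: le_trans (le_trans IH0 _).
    apply: ler_sum => G _.
    by rewrite /= {1}/uncovered ti andbF add0n.
  by rewrite ler_wpM2l ?exprn_ge0 //= [leRHS]exprS ler_peMl // exprn_ge0.
pose P := [pred x : 'I_n * 'I_n | [&& i != x.1, i != x.2 & x.1 != x.2]].
pose T (x : 'I_n * 'I_n) := triangle_edges i x.1 x.2.
(* A union bound over the candidate triangles at [i]: if [i] lies in a triangle of [G], the summand
   of that triangle alone dominates the left side; otherwise [i] is not counted. *)
have step (G : graph n) : E \subset G -> y ^+ count (uncovered E G) (i :: l) <=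
    y ^+ count (uncovered E G) l +
    \sum_(x | P x) (if E :|: T x \subset G then
       y ^+ 3 * y ^+ count (uncovered (E :|: T x)%SET G) l else 0).
  move=> EG.
  have term_ge0 x : 0 <= (if E :|: T x \subset G then
       y ^+ 3 * y ^+ count (uncovered (E :|: T x)%SET G) l else 0).
    by case: ifP => // _; rewrite mulr_ge0 ?exprn_ge0.
  have [tri|ntri] := boolP (in_triangle G i); last first.
    rewrite /= {1}/uncovered (negPf ntri) add0n lerDl.
    by apply: sumr_ge0 => x _.
  case/existsP: tri => a /existsP[b /and3P[ia ab bi]].
  have Pab : P (a, b).
    by rewrite /= (adj_neq ia) (adj_neq ab) eq_sym (adj_neq bi).
  rewrite (bigD1 (a, b)) //= finset.subUset EG (triangle_edges_sub ia ab bi) /=.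
  rewrite -exprD addrCA -[leLHS]addr0 lerD //.
    exact/ler_weXn2l/(count_uncovered_triangle _ _ _ _ ul).
  by rewrite addr_ge0 ?exprn_ge0 //; apply: sumr_ge0.
apply: (@le_trans _ _ (\sum_(G : graph n | E \subset G)
    gnp p G * y ^+ count (uncovered E G) l +
  \sum_(x | P x) y ^+ 3 * \sum_(G : graph n | E :|: T x \subset G)
    gnp p G * y ^+ count (uncovered (E :|: T x)%SET G) l)).
  under [X in _ <= _ + X]eq_bigr => x _ do rewrite mulr_sumr big_mkcond.
  rewrite exchange_big /= big_mkcond [X in _ <= X + _]big_mkcond -big_split /=.
  apply: ler_sum => G _; case: ifPn => [EG|nEG]; last first.
    rewrite add0r; apply: sumr_ge0 => x _; case: ifP => // _.
    by rewrite !mulr_ge0 ?exprn_ge0 ?gnp_ge0.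
  apply: le_trans (ler_wpM2l (gnp_ge0 G) (step G EG)) _.
  rewrite mulrDr lerD2l mulr_sumr; apply: ler_sum => x _.
  by case: ifP; rewrite ?mulr0 // mulrCA.
set D := (1 + y ^+ 3 * c) in IH0 d_ge1 d_ge0 IHl *.
apply: (@le_trans _ _ (p ^+ #|E| * D ^+ size l +
   \sum_(x | P x) y ^+ 3 * (p ^+ #|(E :|: T x)%SET| * D ^+ size l))).
  apply: lerD => //; apply: ler_sum => -[a b] /and3P[ia ib ab].
  rewrite ler_wpM2l ?exprn_ge0 //; apply: IHl => //.
  by have [k [-> k3 _]] := card_add_triangle unt ia ib ab; exact: sE'.
rewrite -mulr_sumr -mulr_suml /= [D ^+ _.+1]exprS -expand.
rewrite lerD2l ler_wpM2l ?exprn_ge0 // ler_wpM2r ?exprn_ge0 //.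
apply: le_trans (triangle_weight unt) _.
rewrite ler_wpM2l ?exprn_ge0 // lerD2l ler_wpM2r ?exprn_ge0 //.
(* The constant 12 arises here, from [4 * #|E|] and the invariant, which gives [#|E| <= 3 * n]. *)
rewrite -!natrM ler_nat -[12%N]/(4 * 3)%N -mulnA leq_pmul2l //.
by rewrite (leq_trans _ sE) // leq_addr.
Qed.

Lemma moment_V_T (y : R) : 1 <= y ->
  \sum_(G : graph n) gnp p G * y ^+ V_T G
  <= (1 + y ^+ 3 * (n%:R ^+ 2 * p ^+ 3 + 12 * n%:R * p ^+ 2)) ^+ n.
Proof.
move=> y_ge1; pose E0 : graph n := finset.set0.
have := @greedy_moment y (enum 'I_n) E0 y_ge1 (enum_uniq _).
rewrite size_enum_ord cards0 add0n leqnn mul1r => /(_ isT).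
apply: le_trans; rewrite le_eqVlt; apply/orP; left; apply/eqP.
apply: eq_big => G; first by rewrite finset.sub0set.
move=> _; congr (_ * y ^+ _).
rewrite /V_T cardE -size_filter; congr size.
rewrite {1}/enum_mem -enumT /=; apply: eq_filter => x.
by rewrite /uncovered touched0 andbT.
Qed.

End Gnp.

(** * Graphs made of disjoint triangles *)

Section DisjointTriangles.
Variables (n m : nat) (f : option bool * 'I_m -> 'I_n).
Hypothesis f_inj : injective f.

(** [f] places three disjoint classes of [m] vertices, tagged [None], [Some true] and [Some false].
    Indexing the blocks by their [None] vertex leaves two free permutations. *)
Definition block (st : {perm 'I_m} * {perm 'I_m}) (j : 'I_m) : {set 'I_n} :=
  [set f (None, j); f (Some true, st.1 j); f (Some false, st.2 j)]%SET.

Definition block_graph (st : {perm 'I_m} * {perm 'I_m}) : graph n :=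
  (\bigcup_j [set e : edge n | val e \subset block st j])%SET.

Lemma adj_block_graph st x y :
  adj (block_graph st) x y =
  (x != y) && [exists j, (x \in block st j) && (y \in block st j)].
Proof.
apply/idP/andP => [a|[neq_xy /existsP[j /andP[xj yj]]]].
  split; first exact: adj_neq a.
  case/adjP: a => e /finset.bigcupP[j _]; rewrite inE => /fintype.subsetP sej ve.
  by apply/existsP; exists j; rewrite !sej ?ve ?inE ?eqxx ?orbT.
have [e ve] := edge_of_neq neq_xy.
apply/adjP; exists e => //; apply/finset.bigcupP; exists j => //.
rewrite inE ve; apply/fintype.subsetP => z.
by rewrite in_set2 => /orP[] /eqP ->.
Qed.

Lemma block_None st j k : (f (None, j) \in block st k) = (j == k).
Proof. by rewrite !inE !(inj_eq f_inj) !xpair_eqE /= !orbF. Qed.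

Lemma block_true st j k :
  (f (Some true, j) \in block st k) = (j == st.1 k).
Proof. by rewrite !inE !(inj_eq f_inj) !xpair_eqE /= !orbF. Qed.

Lemma block_false st j k :
  (f (Some false, j) \in block st k) = (j == st.2 k).
Proof. by rewrite !inE !(inj_eq f_inj) !xpair_eqE /=. Qed.

(** The permutations can be read off: [f (None, j)] has a single neighbour in each of the two other
    classes, with indices [s j] and [t j]. *)
Lemma block_graph_inj : injective block_graph.
Proof.
move=> [s t] [s' t'] eq_st; congr pair; apply/permP => j.
  have : adj (block_graph (s, t)) (f (None, j)) (f (Some true, s j)).
    rewrite adj_block_graph (inj_eq f_inj) /=; apply/existsP; exists j.
    by rewrite block_None block_true !eqxx.
  rewrite eq_st adj_block_graph => /andP[_ /existsP[k]].
  by rewrite block_None block_true /= => /andP[/eqP <- /eqP].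
have : adj (block_graph (s, t)) (f (None, j)) (f (Some false, t j)).
  rewrite adj_block_graph (inj_eq f_inj) /=; apply/existsP; exists j.
  by rewrite block_None block_false !eqxx.
rewrite eq_st adj_block_graph => /andP[_ /existsP[k]].
by rewrite block_None block_false /= => /andP[/eqP <- /eqP].
Qed.

Lemma card_block st j : #|block st j| = 3%N.
Proof.
by rewrite /block -finset.setUA !cardsU1 cards1 !inE !(inj_eq f_inj) !xpair_eqE.
Qed.

Lemma card_block_graph st : (#|block_graph st| <= 3 * m)%N.
Proof.
rewrite -[m in (3 * m)%N]card_ord mulnC -sum_nat_const.
rewrite /block_graph; elim/big_ind2: _ => [|k A l B Ak Bl|j _].
- by rewrite cards0.
- by rewrite (leq_trans (leq_card_setU A B)) // leq_add.
have -> : 3%N = #|[set A : {set 'I_n} | A \subset block st j & #|A| == 2%N]%SET|.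
  by rewrite cards_draws card_block.
rewrite -(card_imset _ val_inj); apply/subset_leq_card/fintype.subsetP => A.
by case/imsetP => e; rewrite !inE => sej ->; rewrite sej (valP e).
Qed.

Lemma V_T_block_graph st : (3 * m <= V_T (block_graph st))%N.
Proof.
have -> : (3 * m)%N = #|[set f x | x in [set: option bool * 'I_m]]%SET|.
  by rewrite card_imset // cardsT card_prod card_option card_bool card_ord.
apply/subset_leq_card/fintype.subsetP => x /imsetP[[c j] _ ->{x}].
pose st_inv := ((st.1)^-1, (st.2)^-1)%g.
(* The index of the block containing [f (c, j)], found by inverting the permutation that placed this
   class. *)
pose k := if c is Some b then (if b then st_inv.1 j else st_inv.2 j) else j.
have xk : f (c, j) \in block st k.
  case: c @k => [[]|] /=; rewrite ?block_true ?block_false ?block_None //=.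
    by rewrite permKV.
  by rewrite permKV.
pose u := f (None, k); pose v := f (Some true, st.1 k).
pose w := f (Some false, st.2 k).
have uk : u \in block st k by rewrite block_None.
have vk : v \in block st k by rewrite block_true.
have wk : w \in block st k by rewrite block_false.
have adjk y z : y \in block st k -> z \in block st k -> y != z ->
    adj (block_graph st) y z.
  move=> yk zk yz; rewrite adj_block_graph yz /=; apply/existsP; exists k.
  by rewrite yk zk.
have uv : u != v by rewrite (inj_eq f_inj).
have uw : u != w by rewrite (inj_eq f_inj).
have vw : v != w by rewrite (inj_eq f_inj).
have tri y z t : y \in block st k -> z \in block st k -> t \in block st k ->
    y != z -> z != t -> t != y -> in_triangle (block_graph st) y.
  move=> *; apply/existsP; exists z; apply/existsP; exists t.
  by rewrite !adjk.
have : f (c, j) \in [:: u; v; w] by move: xk; rewrite !inE orbA.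
rewrite !inE -topredE /= => /or3P[] /eqP ->.
- by apply: (tri u v w) => //; rewrite eq_sym.
- by apply: (tri v w u) => //; rewrite eq_sym.
- by apply: (tri w u v) => //; rewrite eq_sym.
Qed.

End DisjointTriangles.

(** * Lower bounds on the partition function *)

Section ZBounds.
Variables (R : realType) (n : nat) (p gamma : R).
Hypotheses (p_ge0 : 0 <= p) (p_le1 : p <= 1) (gamma_ge0 : 0 <= gamma).

Lemma card_edge : (#|{: edge n}| <= n ^ 2)%N.
Proof.
rewrite card_sig -[X in (X ^ 2)%N]card_ord -[(_ ^ 2)%N]/(_ * _)%N -card_prod.
rewrite -cardsE card_draws card_prod !card_ord bin2.
rewrite (leq_trans (half_leq (leq_mul (leqnn n) (leq_pred n)))) //.
by rewrite leq_half_double; lia.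
Qed.

(** At most [k] edges are present and at most [n ^ 2] absent. The crude second count is affordable:
    for [p] of order [1 / n] it costs a factor [exp (- O(n))]. *)
Lemma gnp_ge (k : nat) (G : graph n) : (#|G| <= k)%N ->
  p ^+ k * (1 - p) ^+ (n ^ 2) <= gnp p G.
Proof.
move=> Gk; have q_ge0 : 0 <= 1 - p by rewrite subr_ge0.
have q_le1 : 1 - p <= 1 by rewrite lerBlDr lerDl.
rewrite /gnp big_if /= !prodr_const.
apply: ler_pM; rewrite ?exprn_ge0 //; apply: ler_wiXn2l => //.
by rewrite (leq_trans (max_card _)) // card_edge.
Qed.

(** The integrand is at least 1. This bound accounts for the 0 in the limit
    [Num.max (beta - 1 / 3) 0]. *)
Lemma Z_ge1 : 1 <= Z n p gamma.
Proof.
rewrite -(sum_gnp n p); apply: ler_sum => G _.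
by rewrite ler_peMr ?gnp_ge0 // -expR0 ler_expR mulr_ge0.
Qed.

(** Only the block graphs are kept in the expectation. They are pairwise distinct by
    [block_graph_inj], with at most [3 * m] edges and at least [3 * m] vertices in triangles. *)
Lemma Z_ge_disjoint_triangles (m : nat) : (3 * m <= n)%N ->
  (m`! ^ 2)%:R * (p ^+ (3 * m) * (1 - p) ^+ (n ^ 2)) *
    expR (gamma * (3 * m)%:R) <= Z n p gamma.
Proof.
move=> mn; have cardP : #|{: option bool * 'I_m}| = (3 * m)%N.
  by rewrite card_prod card_option card_bool card_ord.
pose f (x : option bool * 'I_m) : 'I_n :=
  widen_ord mn (cast_ord cardP (enum_rank x)).
have f_inj : injective f.
  by move=> x y /(congr1 val) /= /ord_inj/enum_rank_inj.
pose S := [set block_graph f st | st in {: {perm 'I_m} * {perm 'I_m}}]%SET.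
rewrite /Z /Ex (bigID [in S]) /= -[leLHS]addr0 lerD //; last first.
  by apply: sumr_ge0 => G _; rewrite mulr_ge0 ?expR_ge0 ?gnp_ge0.
rewrite big_imset /=; last by move=> ? ? _ _; apply: block_graph_inj.
have -> : (m`! ^ 2)%N = #|{: {perm 'I_m} * {perm 'I_m}}|.
  by rewrite card_prod card_Sn.
rewrite -mulrA mulr_natl -sumr_const; apply: ler_sum => st _.
apply: ler_pM; rewrite ?expR_ge0 //.
- by rewrite mulr_ge0 ?exprn_ge0 ?subr_ge0.
- exact/gnp_ge/card_block_graph.
- by rewrite ler_expR ler_wpM2l // ler_nat V_T_block_graph.
Qed.

End ZBounds.

(** * Elementary inequalities for logarithms *)

(** A weak Stirling bound. From [m] to [m.+1] the left side grows by [ln m.+1] plus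
    [m (ln m.+1 - ln m) - 1], and the latter is at most 0. *)
Lemma ln_fact_ge (R : realType) (m : nat) :
  m%:R * ln m%:R - m%:R <= ln (m`!)%:R :> R.
Proof.
elim: m => [|m IHm]; first by rewrite fact0 ln1 mul0r subr0.
have [->|m_gt0] := posnP m; first by rewrite ln1 mulr0 sub0r oppr_le0.
have m0 : 0 < m%:R :> R by rewrite ltr0n.
rewrite factS natrM lnM ?posrE ?ltr0n ?fact_gt0 //.
have step : ln (m.+1%:R : R) - ln m%:R <= m%:R^-1.
  rewrite -ln_div ?posrE ?ltr0n // -natr1 mulrDl mulfV ?gt_eqF // mul1r.
  by rewrite le_ln1Dx // (lt_trans (ltrN10 R)) // invr_gt0.
have := ler_wpM2l (ltW m0) step; rewrite mulrBr mulfV ?gt_eqF //.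
by move: IHm; rewrite -natr1; lra.
Qed.

(** On [[0, 1/2]], [(1 - p) (1 + 2 p) >= 1], while [1 + 2 p <= exp (2 p)]. *)
Lemma ln1B_ge (R : realType) (p : R) : 0 <= p -> p <= 1 / 2 ->
  - (2 * p) <= ln (1 - p).
Proof.
move=> p0 p1; rewrite -ler_expR lnK ?posrE; last lra.
rewrite expRN invf_ple ?posrE ?expR_gt0 //; last lra.
apply: le_trans (expR_ge1Dx _); rewrite invf_ple ?posrE; [|lra|lra].
rewrite -[leLHS]mulr1 ler_pdivrMl; [|lra]; nra.
Qed.

(** * Asymptotics at [p = lambda / n] *)

Section ErdosRenyi.
Variables (R : realType) (lambda beta : R).
Hypotheses (lambda_gt0 : 0 < lambda) (beta_ge0 : 0 <= beta).

Let Zn (n : nat) : R := Z n (lambda / n%:R) (beta * ln n%:R).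
(** The value of [n (n^2 p^3 + 12 n p^2)] at [p = lambda / n], independent of [n]. *)
Let C : R := lambda ^+ 3 + 12 * lambda ^+ 2.

(** Split [n^(beta V_T)] into [n^((beta - 1/3) V_T)], at most [exp M] on [A], and [n^(V_T / 3)],
    whose expectation [moment_V_T] bounds with [y = n^(1/3)]. The full [A] serves for [Z], a
    deviation event for its probability. *)
Lemma partial_Z_le (n : nat) (M : R) (A : {pred graph n}) :
  (0 < n)%N -> lambda <= n%:R ->
  (forall G, G \in A -> (beta - 1 / 3) * ln n%:R * (V_T G)%:R <= M) ->
  \sum_(G : graph n | G \in A)
    gnp (lambda / n%:R) G * expR (beta * ln n%:R * (V_T G)%:R)
  <= expR (M + C * n%:R).
Proof.
move=> n_gt0 lambda_le AM.
have n0 : 0 < n%:R :> R by rewrite ltr0n.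
have p_ge0 : 0 <= lambda / n%:R by rewrite divr_ge0 ?ltW.
have p_le1 : lambda / n%:R <= 1 by rewrite ler_pdivrMr // mul1r.
pose y : R := expR (ln n%:R / 3).
have y3 : y ^+ 3 = n%:R by rewrite -expRM_natr divfK // lnK.
have y_ge0 : 0 <= y by exact: expR_ge0.
have y_ge1 : 1 <= y by rewrite -expR0 ler_expR divr_ge0 // ln_ge0 // ler1n.
apply: (@le_trans _ _ (expR M * \sum_(G : graph n)
    gnp (lambda / n%:R) G * y ^+ V_T G)).
  rewrite mulr_sumr big_mkcond; apply: ler_sum => G _; case: ifP => [GA|_].
    rewrite mulrCA ler_wpM2l ?gnp_ge0 // -expRM_natr -expRD ler_expR.
    by have := AM _ GA; lra.
  by rewrite !mulr_ge0 ?expR_ge0 ?gnp_ge0 ?exprn_ge0.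
rewrite expRD ler_wpM2l ?expR_ge0 //.
apply: le_trans (moment_V_T _ p_ge0 p_le1 y_ge1) _.
have base_ge0 : 0 <= 1 + y ^+ 3 * (n%:R ^+ 2 * (lambda / n%:R) ^+ 3 +
    12 * n%:R * (lambda / n%:R) ^+ 2).
  have lambda_ge0 := ltW lambda_gt0.
  by rewrite addr_ge0 ?mulr_ge0 ?addr_ge0 ?mulr_ge0 ?exprn_ge0 ?invr_ge0 ?ler0n.
rewrite expRM_natr ler_pXn2r ?nnegrE ?expR_ge0 //.
apply: le_trans (expR_ge1Dx _); rewrite y3 lerD2l le_eqVlt.
apply/orP; left; apply/eqP; rewrite /C; field.
by rewrite gt_eqF.
Qed.

Lemma near_ln_ge (K : R) : \forall n \near \oo, K <= ln (n%:R : R).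
Proof.
near=> n; have h : expR K <= n%:R by near: n; exact: nbhs_infty_ger.
by rewrite -ler_expR lnK // posrE (lt_le_trans (expR_gt0 K)).
Unshelve. all: by end_near. Qed.

Lemma near_Zn_ge1 : \forall n \near \oo, 1 <= Zn n.
Proof.
near=> n.
have h : Num.max 1 lambda <= n%:R by near: n; exact: nbhs_infty_ger.
move: h; rewrite ge_max => /andP[n1 nl].
have n0 : 0 < n%:R :> R by exact: lt_le_trans n1.
apply: Z_ge1; first by rewrite divr_ge0 // ltW.
  by rewrite ler_pdivrMr // mul1r.
by rewrite mulr_ge0 // ln_ge0.
Unshelve. all: by end_near. Qed.

Lemma near_ln_Zn_le : \forall n \near \oo,
  ln (Zn n) <= Num.max (beta - 1 / 3) 0 * ln n%:R * n%:R + C * n%:R.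
Proof.
near=> n.
have h : Num.max 1 lambda <= n%:R by near: n; exact: nbhs_infty_ger.
move: h; rewrite ge_max => /andP[n1 nl].
have Z1 : 1 <= Zn n by near: n; exact: near_Zn_ge1.
rewrite -ler_expR lnK ?posrE ?(lt_le_trans _ Z1) //.
apply: (@partial_Z_le n _ predT); rewrite -?(ltr0n R) ?(lt_le_trans _ n1) //.
move=> G _; set c := Num.max _ _.
have c0 : 0 <= c by rewrite /c le_max lexx orbT.
have cb : beta - 1 / 3 <= c by rewrite /c le_max lexx.
have L0 : 0 <= ln n%:R :> R by exact: ln_ge0.
apply: (@le_trans _ _ (c * ln n%:R * (V_T G)%:R)).
  by rewrite ler_wpM2r // ler_wpM2r.
rewrite ler_wpM2l ?mulr_ge0 // ler_nat /V_T.
by rewrite (leq_trans (max_card _)) // card_ord.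
Unshelve. all: by end_near. Qed.

(** The main terms are [2 m ln m] from the count of graphs, [- 3 m ln n] from [p ^+ (3 * m)] and
    [3 m beta ln n] from the tilt. In the linear error, [ln 5 + 1] comes from Stirling and from
    comparing [ln m] with [ln n], the [lambda] terms from the present and the absent edges, and
    [2 * beta] from the at most two vertices left over. *)
Lemma ln_Zn_ge (n : nat) : 3 <= n%:R :> R -> 2 * lambda <= n%:R ->
  (beta - 1 / 3) * ln n%:R * n%:R -
    (ln 5 + 1 + `|ln lambda| + 2 * lambda + 2 * beta) * n%:R <= ln (Zn n).
Proof.
move=> n3 n2l.
have n0 : 0 < n%:R :> R by lra.
pose m := (n %/ 3)%N.
have m_le : (3 * m <= n)%N by rewrite /m; lia.
have m_ge : (n <= 3 * m + 2)%N by rewrite /m; lia.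
have m_gt0 : (0 < m)%N by move: n3; rewrite ler_nat /m; lia.
(* As [m >= 1], [3 m + 2 <= 5 m], with equality at [n = 5]. *)
have n_le : (n <= 5 * m)%N by lia.
have m0 : 0 < m%:R :> R by rewrite ltr0n.
have m_leR : 3 * m%:R <= n%:R :> R by rewrite -natrM ler_nat.
have m_geR : n%:R <= 3 * m%:R + 2 :> R by rewrite -natrM -natrD ler_nat.
pose p := lambda / n%:R.
have p_gt0 : 0 < p by rewrite divr_gt0.
have p_half : p <= 1 / 2 by rewrite /p ler_pdivrMr //; lra.
have p_lt1 : 0 < 1 - p by lra.
have L0 : 0 <= ln n%:R :> R by rewrite ln_ge0 //; lra.
have Ln : ln n%:R <= n%:R :> R by rewrite ltW // ln_sublinear.
have p_le1 : p <= 1 by lra.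
have gamma_ge0 := mulr_ge0 beta_ge0 L0.
have Z0 := lt_le_trans ltr01 (Z_ge1 n (ltW p_gt0) p_le1 gamma_ge0).
have := Z_ge_disjoint_triangles (ltW p_gt0) p_le1 gamma_ge0 m_le.
have fact0 : 0 < (m`! ^ 2)%:R :> R by rewrite ltr0n expn_gt0 fact_gt0.
have pos1 : 0 < p ^+ (3 * m) * (1 - p) ^+ (n ^ 2) by rewrite mulr_gt0 ?exprn_gt0.
have pos2 := mulr_gt0 fact0 pos1.
rewrite -ler_ln ?posrE ?(mulr_gt0 _ (expR_gt0 _)) //.
move=> /(le_trans _); apply.
rewrite lnM ?posrE ?expR_gt0 // expRK lnM ?posrE // lnM ?posrE ?exprn_gt0 //.
have lnX (a : R) k : 0 < a -> ln (a ^+ k) = k%:R * ln a.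
  by move=> a0; rewrite lnXn // mulr_natl.
have lnp : ln p = ln lambda - ln n%:R by rewrite /p ln_div ?posrE.
rewrite (natrX _ m`! 2) (lnX _ 2%N) ?ltr0n ?fact_gt0 //.
rewrite (lnX p (3 * m)%N) // (lnX (1 - p) (n ^ 2)%N) // lnp.
rewrite (natrM _ 3 m) (natrX _ n 2).
have lnm : ln n%:R <= ln 5 + ln m%:R :> R.
  by rewrite -lnM ?posrE ?ler_ln ?posrE ?mulr_gt0 // -natrM ler_nat.
have lm := ln_fact_ge R m.
have q := ln1B_ge (ltW p_gt0) p_half.
have q2 : - (2 * lambda * n%:R) <= n%:R ^+ 2 * ln (1 - p).
  apply: le_trans (ler_wpM2l _ q); last by rewrite exprn_ge0.
  rewrite le_eqVlt; apply/orP; left; apply/eqP; rewrite /p; field.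
  by rewrite gt_eqF.
have h1 : m%:R * ln n%:R <= m%:R * (ln 5 + ln m%:R) :> R.
  by rewrite ler_wpM2l // ltW.
have l5 : 0 <= ln 5 :> R by rewrite ln_ge0 // ler1n.
have h2 : m%:R * (2 * (ln 5 + 1)) <= n%:R * (ln 5 + 1) :> R by nra.
have h3 : - (n%:R * `|ln lambda|) <= 3 * m%:R * ln lambda.
  have := lerNnormlW (lexx `|ln lambda|); have := normr_ge0 (ln lambda); nra.
have h4 : 3 * m%:R * ln n%:R <= n%:R * ln n%:R :> R by rewrite ler_wpM2r.
have h5 : beta * (ln n%:R * n%:R) <= beta * (ln n%:R * (3 * m%:R) + 2 * n%:R).
  rewrite ler_wpM2l // (@le_trans _ _ (ln n%:R * (3 * m%:R + 2))) //.
    by rewrite ler_wpM2l.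
  by lra.
lra.
Qed.

Lemma near_ln_Zn_ge : exists D : R, \forall n \near \oo,
  (beta - 1 / 3) * ln n%:R * n%:R - D * n%:R <= ln (Zn n).
Proof.
exists (ln 5 + 1 + `|ln lambda| + 2 * lambda + 2 * beta); near=> n.
have h : Num.max 3 (2 * lambda) <= n%:R by near: n; exact: nbhs_infty_ger.
by move: h; rewrite ge_max => /andP[]; exact: ln_Zn_ge.
Unshelve. all: by end_near. Qed.

Lemma cvg_log_partition :
  (fun n : nat => (n%:R * ln n%:R)^-1 * ln (Zn n)) @ \oo
    --> Num.max (beta - 1 / 3) 0.
Proof.
have [D hD] := near_ln_Zn_ge.
apply/cvgrPdist_le => e e_gt0; near=> n.
set c := Num.max _ _.
have n1 : 1 <= n%:R :> R by near: n; exact: nbhs_infty_ger.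
have L1 : 1 <= ln n%:R :> R by near: n; exact: near_ln_ge.
(* This threshold makes the linear error [(|C| + |D|) n] at most [e n ln n]. *)
have LK : (`|C| + `|D|) / e <= ln n%:R by near: n; exact: near_ln_ge.
have up : ln (Zn n) <= c * ln n%:R * n%:R + C * n%:R.
  by near: n; exact: near_ln_Zn_le.
have lo : (beta - 1 / 3) * ln n%:R * n%:R - D * n%:R <= ln (Zn n).
  by near: n; exact: hD.
have Z1 : 1 <= Zn n by near: n; exact: near_Zn_ge1.
(* For [beta <= 1/3], where [c] is 0, this comes from [Z1]; otherwise from [lo]. *)
have lo' : c * ln n%:R * n%:R - `|D| * n%:R <= ln (Zn n).
  have Dn : D * n%:R <= `|D| * n%:R by rewrite ler_wpM2r // ler_norm.
  rewrite /c; case: (leP (beta - 1 / 3) 0) => _; last by lra.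
  have := ln_ge0 Z1; have := mulr_ge0 (normr_ge0 D) (ler0n R n); lra.
have nL : 0 < n%:R * ln n%:R :> R by rewrite mulr_gt0 //; lra.
have -> : c - (n%:R * ln n%:R)^-1 * ln (Zn n) =
    (n%:R * ln n%:R)^-1 * (c * ln n%:R * n%:R - ln (Zn n)).
  by field; rewrite !gt_eqF //; lra.
rewrite normrM gtr0_norm ?invr_gt0 // ler_pdivrMl //.
have bound : (`|C| + `|D|) * n%:R <= n%:R * ln n%:R * e.
  by rewrite mulrC -mulrA ler_wpM2l // -ler_pdivrMr.
have Cn : C * n%:R <= `|C| * n%:R by rewrite ler_wpM2r // ler_norm.
have := mulr_ge0 (normr_ge0 C) (ler0n R n).
have := mulr_ge0 (normr_ge0 D) (ler0n R n).
by rewrite ler_norml => *; apply/andP; split; lra.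
Unshelve. all: by end_near. Qed.

(** On the deviation event the exponent [(beta - 1/3) V_T ln n] falls short of [ln (Zn n)] by
    [kappa n ln n] up to [O(n)]; this gap beats the linear cost in [partial_Z_le]. *)
Lemma ergm_cvg_in_probability (c : R) :
  (forall eps : R, 0 < eps -> exists kappa K : R, 0 < kappa /\
    \forall n \near \oo, forall G : graph n,
      eps < `|(V_T G)%:R / n%:R - c| ->
      (beta - 1 / 3) * ln n%:R * (V_T G)%:R <=
        ln (Zn n) - kappa * ln n%:R * n%:R + K * n%:R) ->
  cvg_in_probability
    (fun n => @ergm R n (lambda / n%:R) (beta * ln n%:R))
    (fun n G => (V_T G)%:R / n%:R) c.
Proof.
move=> H eps /H [kappa [K [kappa_gt0 hV]]].
apply/cvgrPdist_le => e e_gt0; near=> n.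
have h : Num.max 1 lambda <= n%:R by near: n; exact: nbhs_infty_ger.
move: h; rewrite ge_max => /andP[n1 nl].
have ne : e^-1 <= n%:R by near: n; exact: nbhs_infty_ger.
(* Beyond this threshold [kappa ln n - K - C >= 1], so the probability is at most [exp (- n)], which
   [ne] makes at most [e]. *)
have LK : (K + C + 1) / kappa <= ln n%:R by near: n; exact: near_ln_ge.
have Z1 : 1 <= Zn n by near: n; exact: near_Zn_ge1.
have Z0 : 0 < Zn n by exact: lt_le_trans Z1.
have n0 : 0 < n%:R :> R by exact: lt_le_trans n1.
have p_ge0 : 0 <= lambda / n%:R by rewrite divr_ge0 // ltW.
have p_le1 : lambda / n%:R <= 1 by rewrite ler_pdivrMr // mul1r.
have hVn : forall G : graph n, eps < `|(V_T G)%:R / n%:R - c| ->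
    (beta - 1 / 3) * ln n%:R * (V_T G)%:R <=
      ln (Zn n) - kappa * ln n%:R * n%:R + K * n%:R.
  by near: n; exact: hV.
set A := [pred G | _].
have Pr_eq : Pr (@ergm R n (lambda / n%:R) (beta * ln n%:R)) A = (Zn n)^-1 *
    \sum_(G : graph n | G \in A)
      gnp (lambda / n%:R) G * expR (beta * ln n%:R * (V_T G)%:R).
  rewrite /Pr mulr_sumr; apply: eq_bigr => G _.
  by rewrite /ergm -mulrA; congr (_ * _); rewrite mulrC.
have Pr_ge0 : 0 <= Pr (@ergm R n (lambda / n%:R) (beta * ln n%:R)) A.
  rewrite Pr_eq mulr_ge0 //; first by rewrite invr_ge0 ltW.
  apply: sumr_ge0 => G _; rewrite mulr_ge0 ?expR_ge0 //.
  exact: gnp_ge0.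
rewrite sub0r normrN ger0_norm // Pr_eq ler_pdivrMl //.
apply: (le_trans (partial_Z_le _ nl hVn)); first by rewrite -(ltr0n R).
have kL : K + C + 1 <= kappa * ln n%:R by rewrite mulrC -ler_pdivrMr.
have kLn := ler_wpM2r (ler0n R n) kL.
apply: (@le_trans _ _ (expR (ln (Zn n)) * expR (- n%:R))).
  by rewrite -expRD ler_expR; lra.
rewrite lnK // ler_wpM2l ?(ltW Z0) //.
rewrite expRN invf_ple ?posrE ?expR_gt0 //.
apply: le_trans (le_trans ne _) (expR_ge1Dx _); lra.
Unshelve. all: by end_near. Qed.

End ErdosRenyi.

Theorem corollary1p10 (R : realType) (lambda beta : R)
    (lambda_gt0 : 0 < lambda) (beta_ge0 : 0 <= beta) :
  [/\ (fun n : nat => (n%:R * ln n%:R)^-1 *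
         ln (Z n (lambda / n%:R) (beta * ln n%:R))) @ \oo
        --> Num.max (beta - 1 / 3) 0,
      beta < 1 / 3 ->
        cvg_in_probability
          (fun n => @ergm R n (lambda / n%:R) (beta * ln n%:R))
          (fun n G => (V_T G)%:R / n%:R) 0
    & 1 / 3 < beta ->
        cvg_in_probability
          (fun n => @ergm R n (lambda / n%:R) (beta * ln n%:R))
          (fun n G => (V_T G)%:R / n%:R) 1].
Proof.
split; first exact: cvg_log_partition.
- move=> beta_lt; apply: ergm_cvg_in_probability => // eps eps_gt0.
  (* [V_T > eps n] pushes the negative exponent below [- kappa n ln n], while [ln Z >= 0]. *)
  exists ((1 / 3 - beta) * eps), 0; split; first by rewrite mulr_gt0 ?subr_gt0.
  near=> n => G.
  have n1 : 1 <= n%:R :> R by near: n; exact: nbhs_infty_ger.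
  have n0 : 0 < n%:R :> R by exact: lt_le_trans n1.
  have Z1 : 1 <= Z n (lambda / n%:R) (beta * ln n%:R).
    by near: n; exact: near_Zn_ge1.
  rewrite subr0 ger0_norm ?divr_ge0 // ltr_pdivlMr // => V_gt.
  have L0 : 0 <= ln n%:R :> R by exact: ln_ge0.
  have := ler_wpM2l (mulr_ge0 (ltW (_ : 0 < 1 / 3 - beta)) L0) (ltW V_gt).
  by rewrite subr_gt0 => /(_ beta_lt); have := ln_ge0 Z1; lra.
- move=> beta_gt; apply: ergm_cvg_in_probability => // eps eps_gt0.
  have [D hD] := near_ln_Zn_ge lambda_gt0 beta_ge0.
  (* As [V_T <= n], the deviation means [V_T < (1 - eps) n]. The exponent then loses [kappa n ln n]
     against the lower bound on [ln Z], whose linear error [D] pays for. *)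
  exists ((beta - 1 / 3) * eps), D; split; first by rewrite mulr_gt0 ?subr_gt0.
  near=> n => G.
  have n1 : 1 <= n%:R :> R by near: n; exact: nbhs_infty_ger.
  have n0 : 0 < n%:R :> R by exact: lt_le_trans n1.
  have lo : (beta - 1 / 3) * ln n%:R * n%:R - D * n%:R <=
      ln (Z n (lambda / n%:R) (beta * ln n%:R)) by near: n; exact: hD.
  have V_le : (V_T G)%:R / n%:R <= 1 :> R.
    rewrite ler_pdivrMr // mul1r ler_nat /V_T.
    by rewrite (leq_trans (max_card _)) // card_ord.
  rewrite ler0_norm ?subr_le0 // opprB ltrBrDr -ltrBrDl ltr_pdivrMr // => V_lt.
  have L0 : 0 <= ln n%:R :> R by exact: ln_ge0.
  have := ler_wpM2l (mulr_ge0 (ltW (_ : 0 < beta - 1 / 3)) L0) (ltW V_lt).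
  by rewrite subr_gt0 => /(_ beta_gt); lra.
Unshelve. all: by end_near. Qed.
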